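(* Let $\Gamma=(V,E)$ be a finite simple graph with $\mathrm{Aut}(\Gamma)=\{\mathrm{Id}\}$ and $\mathrm{Aut}^{\pi}(\Gamma) \neq \{\mathrm{Id}\}$. Then $\mathrm{Aut}^{\pi}(\Gamma)$ is an abelian group of odd order; for every $\pi \in \mathrm{Aut}^{\pi}(\Gamma)$ and every $v \in V$ one has $\pi(N(v)) = N(\pi^{-1}(v))$ (i.e. $\gamma(\pi)=\pi^{-1}$); and the subgraph of $\Gamma$ induced by any orbit of $\mathrm{Aut}^{\pi}(\Gamma)$ on $V$ has no edges.
   Context: For a vertex $v$, $N(v)=\{w : (v,w)\in E\}$. $\mathrm{Aut}^{\pi}(\Gamma)$ is the group of bijections $\pi: V\to V$ such that for every $v\in V$ there exists $w\in V$ with $\pi(N(v)) = N(w)$. For a reduced graph (one in which $N(v)=N(w)$ implies $v=w$) and $\pi\in\mathrm{Aut}^{\pi}(\Gamma)$, $\gamma(\pi)$ denotes the permutation with $N(\gamma(\pi)(v)) = \pi(N(v))$ for all $v$. *)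

(* Defs.v *)
From mathcomp Require Import all_boot all_fingroup.

Set Implicit Arguments.
Unset Strict Implicit.
Unset Printing Implicit Defensive.

Local Open Scope group_scope.

(* A finite simple graph on V is a symmetric irreflexive relation [e : rel V].
   Both hypotheses are stated explicitly wherever they are needed. *)
Section GraphAut.

Variables (V : finType) (e : rel V).
Implicit Types (p g : {perm V}) (v w : V).

Definition nbh v : {set V} := [set w | e v w].

Definition reduced : Prop := injective nbh.

Definition graph_aut : {set {perm V}} :=
  [set p : {perm V} | [forall v, forall w, e (p v) (p w) == e v w]].

Definition nbh_aut : {set {perm V}} :=
  [set p : {perm V} | [forall v, exists w, p @: nbh v == nbh w]].

Lemma graph_autP p :
  reflect (forall v w, e (p v) (p w) = e v w) (p \in graph_aut).
Proof.
rewrite inE; apply: (iffP forallP) => h v; last first.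
  by apply/forallP => w; apply/eqP.
by move=> w; apply/eqP; move/forallP: (h v); apply.
Qed.

Lemma nbh_autP p :
  reflect (forall v, exists w, p @: nbh v = nbh w) (p \in nbh_aut).
Proof.
rewrite inE; apply: (iffP forallP) => h v.
  by have /existsP[w /eqP hw] := h v; exists w.
by have [w hw] := h v; apply/existsP; exists w; apply/eqP.
Qed.

Lemma graph_aut_group_set : group_set graph_aut.
Proof.
apply/group_setP; split; first by apply/graph_autP => v w; rewrite !perm1.
move=> p q /graph_autP hp /graph_autP hq; apply/graph_autP => v w.
by rewrite !permM hq hp.
Qed.

Canonical graph_aut_group := Group graph_aut_group_set.

Lemma nbh_aut_group_set : group_set nbh_aut.
Proof.
apply/group_setP; split.
  apply/nbh_autP => v; exists v; apply/setP => x.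
  by rewrite -{1}[x](perm1 x) mem_imset //; apply: perm_inj.
move=> p q /nbh_autP hp /nbh_autP hq; apply/nbh_autP => v.
have [w hw] := hp v; have [u hu] := hq w; exists u.
by rewrite -hu -hw -imset_comp; apply: eq_imset => x; rewrite /= permM.
Qed.

Canonical nbh_aut_group := Group nbh_aut_group_set.

(* For a reduced graph and p in [nbh_aut], the permutation g characterised by
   N (g v) = p (N v) exists and is unique (see [gammaE] and [gamma_uniq]);
   otherwise [gamma p] carries no meaning. A graph with trivial automorphism
   group is reduced, since exchanging two twins is an automorphism. *)
Definition gamma p : {perm V} :=
  odflt 1 [pick g : {perm V} | [forall v, nbh (g v) == p @: nbh v]].

Lemma gammaE p v : reduced -> p \in nbh_aut -> nbh (gamma p v) = p @: nbh v.
Proof.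
move=> red /nbh_autP hp; rewrite /gamma; case: pickP => [g|none].
  by move=> /forallP/(_ v)/eqP.
have hp' u : exists w, p @: nbh u == nbh w.
  by have [w hw] := hp u; exists w; apply/eqP.
pose f u := xchoose (hp' u).
have fE u : nbh (f u) = p @: nbh u by rewrite -(eqP (xchooseP (hp' u))).
have f_inj : injective f.
  move=> u w /(congr1 nbh); rewrite !fE => /imset_inj - /(_ (@perm_inj _ p)).
  exact: red.
have /negP[] := negbT (none (perm f_inj)).
by apply/forallP => u; rewrite permE fE.
Qed.

Lemma gamma_uniq p g :
  reduced -> (forall v, nbh (g v) = p @: nbh v) -> gamma p = g.
Proof.
move=> red hg; rewrite /gamma; case: pickP => [g' /forallP hg'|none].
  by apply/permP => v; apply: red; rewrite hg (eqP (hg' v)).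
by have /forallP[] := negbT (none g) => v; apply/eqP.
Qed.

End GraphAut.

(* Main.v *)
(* Write g = gamma p, so that [e (g v) (p w) = e v w]. This relation between g
   and p is symmetric because e is, so gamma is an involutive automorphism of
   the group of neighbourhood automorphisms, and its fixed points are the graph
   automorphisms. As only the identity is fixed, gamma is inversion, and the
   group is abelian of odd order. Every element of it is then a square s ^ 2,
   and [e x (s (s x)) = e (s x) (s x)] is false. *)
Require Import Defs.
From mathcomp Require Import all_boot all_fingroup.
From mathcomp Require Import cyclic pgroup.

Set Implicit Arguments.
Unset Strict Implicit.
Unset Printing Implicit Defensive.

Local Open Scope group_scope.

Section FixedPointFreeInvolution.

Variables (gT : finGroupType) (G : {group gT}) (phi : gT -> gT).
Hypothesis phi_in : {in G, forall x, phi x \in G}.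
Hypothesis phiM : {in G &, {morph phi : x y / x * y}}.
Hypothesis phiK : {in G, involutive phi}.
Hypothesis phi_fix : {in G, forall x, phi x = x -> x = 1}.

(* The map y |-> y^-1 * phi y is injective on G, hence onto G, and phi inverts
   its values. *)
Lemma fpf_involution_inv : {in G, forall x, phi x = x^-1}.
Proof.
have phi1 : phi 1 = 1.
  by apply: (mulgI (phi 1)); rewrite -phiM ?group1 // !mulg1.
have phiV : {in G, {morph phi : x / x^-1}}.
  move=> x Gx; apply: (mulgI (phi x)).
  by rewrite -phiM ?groupV // !mulgV phi1.
pose f y := y^-1 * phi y.
have f_inj : {in G &, injective f}.
  move=> y z Gy Gz eq_f; apply/eqP; rewrite eq_mulgV1; apply/eqP.
  (* From [f y = f z], [phi y = y * z^-1 * phi z], so [phi] fixes [y * z^-1]. *)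
  apply: phi_fix; first by rewrite groupM ?groupV.
  rewrite phiM ?groupV // phiV //.
  have -> : phi y = y * z^-1 * phi z.
    by rewrite -mulgA -[z^-1 * _]/(f z) -eq_f mulKVg.
  by rewrite mulgK.
have f_onto : f @: G = G.
  apply/eqP; rewrite eqEcard card_in_imset // leqnn andbT.
  by apply/subsetP => _ /imsetP[y Gy ->]; rewrite groupM ?groupV ?phi_in.
move=> x; rewrite -{1}f_onto => /imsetP[y Gy ->].
by rewrite /f phiM ?groupV ?phi_in // phiV // phiK // invMg invgK.
Qed.

(** Inversion always reverses products; as the morphism [phi] it also preserves them. *)
Lemma fpf_involution_abelian : abelian G.
Proof.
apply/centsP => x Gx y Gy; apply: invg_inj.
by rewrite -fpf_involution_inv ?groupM // phiM // !fpf_involution_inv // invMg.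
Qed.

(** An element of order 2 is its own inverse, hence a nontrivial fixed point of [phi]. *)
Lemma fpf_involution_odd : odd #|G|.
Proof.
rewrite -[odd _]negbK -dvdn2; apply/negP => /(@Cauchy _ 2 _ isT)[x Gx ox].
suff x1 : x = 1 by rewrite x1 order1 in ox.
by apply: phi_fix; rewrite // fpf_involution_inv // invg2id.
Qed.

End FixedPointFreeInvolution.

Lemma odd_group_sqrt (gT : finGroupType) (G : {group gT}) x :
  odd #|G| -> x \in G -> exists2 s, s \in G & x = s * s.
Proof.
(* For odd n = [#|G|] the exponent is (n + 1) / 2, and x ^ (n + 1) = x. *)
move=> oddG Gx; exists (x ^+ (#|G|./2).+1); first exact: groupX.
have half2 : (#|G|./2).*2.+1 = #|G| by rewrite -[RHS]odd_double_half oddG.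
by rewrite -expgD addnn doubleS half2 expgS expg_cardG ?mulg1.
Qed.

Section NeighbourhoodAutomorphisms.

Variables (V : finType) (e : rel V).
Hypothesis e_sym : symmetric e.
Implicit Types p q : {perm V}.

Lemma graph_aut1_reduced : graph_aut e = [set 1] -> reduced e.
Proof.
move=> aut1 v w Nvw.
(* Swapping the twins in one argument leaves [e] unchanged; symmetry covers the other argument. *)
have eN a b : e (tperm v w a) b = e a b.
  have: (b \in nbh e v) = (b \in nbh e w) by rewrite Nvw.
  by rewrite !inE; case: tpermP => [->|->|].
have : tperm v w \in graph_aut e.
  by apply/graph_autP => a b; rewrite eN e_sym eN.
by rewrite aut1 => /set1P t1; rewrite -(tpermL v w) t1 perm1.
Qed.

Hypothesis red : reduced e.

Lemma gamma_adj p v w : p \in nbh_aut e -> e (gamma e p v) (p w) = e v w.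
Proof.
move=> Ap; have := gammaE v red Ap => /setP/(_ (p w)).
by rewrite mem_imset ?inE //; apply: perm_inj.
Qed.

(** Converse of [gamma_adj]: later, one adjacency identity yields both membership and the value of
    [gamma]. *)
Lemma adj_gamma p q : (forall v w, e (q v) (p w) = e v w) ->
  p \in nbh_aut e /\ gamma e p = q.
Proof.
move=> adj; have qE v : nbh e (q v) = p @: nbh e v.
  apply/setP => w; rewrite -[w](permKV p) mem_imset ?inE ?adj //.
  exact: perm_inj.
by split; [apply/nbh_autP => v; exists (q v) | apply: gamma_uniq].
Qed.

Lemma gamma_swap p :
  p \in nbh_aut e -> gamma e p \in nbh_aut e /\ gamma e (gamma e p) = p.
Proof.
(* By symmetry of [e], [p] and [gamma e p] exchange roles in [gamma_adj]. *)
by move=> Ap; apply: adj_gamma => v w; rewrite e_sym gamma_adj // e_sym.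
Qed.

Lemma gammaM : {in nbh_aut e &, {morph gamma e : p q / p * q}}.
Proof.
move=> p q Ap Aq; have [//|_ ->//] := @adj_gamma (p * q) (gamma e p * gamma e q).
by move=> v w; rewrite !permM !gamma_adj.
Qed.

Lemma gamma_fix_aut p : p \in nbh_aut e -> gamma e p = p -> p \in graph_aut e.
Proof.
move=> Ap fix_p; apply/graph_autP => v w.
by rewrite -{1}fix_p gamma_adj.
Qed.

End NeighbourhoodAutomorphisms.

Theorem theorem6p2 (V : finType) (e : rel V)
    (e_sym : symmetric e) (e_irr : irreflexive e)
    (aut_triv : graph_aut e = [set 1]) (nbh_aut_nontriv : nbh_aut e <> [set 1]) :
  [/\ abelian (nbh_aut e),
      odd #|nbh_aut e|,
      forall p : {perm V}, p \in nbh_aut e ->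
        (forall v : V, p @: nbh e v = nbh e (p^-1 v)) /\ gamma e p = p^-1
    & forall v : V, {in orbit 'P (nbh_aut e) v &, forall x y, ~~ e x y}].
Proof.
have red := graph_aut1_reduced e_sym aut_triv.
have gamma_in : {in nbh_aut e, forall p, gamma e p \in nbh_aut e}.
  by move=> p /(gamma_swap e_sym red)[].
have gammaK : {in nbh_aut e, involutive (gamma e)}.
  by move=> p /(gamma_swap e_sym red)[].
have gamma_fix : {in nbh_aut e, forall p, gamma e p = p -> p = 1}.
  by move=> p Ap /(gamma_fix_aut red Ap); rewrite aut_triv => /set1P.
have gM := gammaM red.
have gammaV := fpf_involution_inv gamma_in gM gammaK gamma_fix.
have oddA := fpf_involution_odd gamma_in gM gammaK gamma_fix.
split=> //.
- exact: fpf_involution_abelian gamma_in gM gammaK gamma_fix.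
- by move=> p Ap; split=> [v|]; rewrite -?gammaV // gammaE.
move=> v _ y /orbitP[p Ap <-] /orbitP[q Aq <-] /=; rewrite /aperm.
(* The element [p^-1 * q] carries [p v] to [q v], as products of permutations act left factor
   first. *)
have [|s As eq_s] := @odd_group_sqrt _ _ (p^-1 * q) oddA.
  by rewrite groupM ?groupV.
have -> : q v = s (s (p v)) by rewrite -!permM -eq_s mulKVg.
(* Since [p v] is [gamma e s] applied to [s (p v)], an edge here would be a loop at [s (p v)]. *)
by rewrite -{1}[p v](permK s) -gammaV // gamma_adj // e_irr.
Qed.
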